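(* The set $\mathbb{W}$ (that is, $\mathbb{R}^4$ with componentwise addition $\oplus$, the usual scalar multiplication, and the multiplication $\otimes$) is an associative, commutative algebra over the field $\mathbb{R}$ with multiplicative identity $\mathbf{1}=(1,0,0,0)$.
   Context: Let $\mathbb{E}_4$ be the Euclidean vector space $\mathbb{R}^4$ over $\mathbb{R}$ with standard vector addition, denoted $\oplus$, and standard scalar multiplication. Its standard basis is written $\mathbf{1}=(1,0,0,0)$, $\mathbf{i}=(0,1,0,0)$, $\mathbf{j}=(0,0,1,0)$, $\mathbf{k}=(0,0,0,1)$, and the coordinates of $\mathbf{x}$ are written $\mathbf{x}=(X_{\mathbf{1}},X_{\mathbf{i}},X_{\mathbf{j}},X_{\mathbf{k}})$. For $\mathbf{x}=(X_{\mathbf{1}},X_{\mathbf{i}},X_{\mathbf{j}},X_{\mathbf{k}})$ and $\mathbf{y}=(Y_{\mathbf{1}},Y_{\mathbf{i}},Y_{\mathbf{j}},Y_{\mathbf{k}})$ define $$\mathbf{x}\otimes\mathbf{y}=(X_{\mathbf{1}}Y_{\mathbf{1}}-X_{\mathbf{i}}Y_{\mathbf{k}}-X_{\mathbf{j}}Y_{\mathbf{j}}-X_{\mathbf{k}}Y_{\mathbf{i}})\,\mathbf{1}\oplus(X_{\mathbf{1}}Y_{\mathbf{i}}+X_{\mathbf{i}}Y_{\mathbf{1}}-X_{\mathbf{j}}Y_{\mathbf{k}}-X_{\mathbf{k}}Y_{\mathbf{j}})\,\mathbf{i}\oplus(X_{\mathbf{1}}Y_{\mathbf{j}}+X_{\mathbf{i}}Y_{\mathbf{i}}+X_{\mathbf{j}}Y_{\mathbf{1}}-X_{\mathbf{k}}Y_{\mathbf{k}})\,\mathbf{j}\oplus(X_{\mathbf{1}}Y_{\mathbf{k}}+X_{\mathbf{i}}Y_{\mathbf{j}}+X_{\mathbf{j}}Y_{\mathbf{i}}+X_{\mathbf{k}}Y_{\mathbf{1}})\,\mathbf{k}.$$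 $\mathbb{W}$ denotes $\mathbb{E}_4$ equipped with $\otimes$. *)

(* Defs.v *)
From HB Require Import structures.
From mathcomp Require Import all_boot all_order all_algebra.
From mathcomp Require Import reals.

Set Implicit Arguments.
Unset Strict Implicit.
Unset Printing Implicit Defensive.

Import GRing.Theory.
Local Open Scope ring_scope.

(* The coordinates (X_1, X_i, X_j, X_k) of x are x 0 0, x 0 1, x 0 2, x 0 3. *)
Definition W1 (R : realType) : 'rV[R]_4 := delta_mx 0 0.
Definition Wi (R : realType) : 'rV[R]_4 := delta_mx 0 1.
Definition Wj (R : realType) : 'rV[R]_4 := delta_mx 0 2.
Definition Wk (R : realType) : 'rV[R]_4 := delta_mx 0 3.

Definition Wmul (R : realType) (x y : 'rV[R]_4) : 'rV[R]_4 :=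
    (x 0 0 * y 0 0 - x 0 1 * y 0 3 - x 0 2 * y 0 2 - x 0 3 * y 0 1) *: W1 R
  + (x 0 0 * y 0 1 + x 0 1 * y 0 0 - x 0 2 * y 0 3 - x 0 3 * y 0 2) *: Wi R
  + (x 0 0 * y 0 2 + x 0 1 * y 0 1 + x 0 2 * y 0 0 - x 0 3 * y 0 3) *: Wj R
  + (x 0 0 * y 0 3 + x 0 1 * y 0 2 + x 0 2 * y 0 1 + x 0 3 * y 0 0) *: Wk R.

(* The carrier of V itself bears an instance A of the associative, commutative,
   unital algebra structure comAlgType K, whose addition and scaling are the
   given ones of V and whose product and unit are mul and one.
   comAlgType also requires 1 != 0, hence excludes the zero algebra. *)
Definition is_comAlgebra (K : fieldType) (V : lmodType K)
    (mul : V -> V -> V) (one : V) : Prop :=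
  exists c : GRing.ComAlgebra.axioms_ K V,
    let A : comAlgType K := GRing.ComAlgebra.Pack c in
    [/\ forall x y : V, @GRing.add A x y = x + y,
        forall (a : K) (x : V), @GRing.scale K A a x = a *: x,
        forall x y : V, @GRing.mul A x y = mul x y
      & @GRing.one A = one].

(* Main.v *)
Require Import Defs.
From HB Require Import structures.
From mathcomp Require Import all_boot all_order all_algebra.
From mathcomp Require Import reals.
From mathcomp Require Import ring.

Import GRing.Theory.
Local Open Scope ring_scope.

(** The vectors [Wi], [Wj], [Wk] multiply like t, t^2, t^3 modulo t^4 = -1, so [Wmul] is the product
    of R[t]/(t^4 + 1), a commutative algebra. The laws are checked by coordinates rather than
    through this quotient: [row4P] and [WmulE] turn each into four polynomial identities over R,
    which [ring] decides. *)

Lemma WmulE (R : realType) (x y : 'rV[R]_4) :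
  [/\ Wmul x y 0 0
        = x 0 0 * y 0 0 - x 0 1 * y 0 3 - x 0 2 * y 0 2 - x 0 3 * y 0 1,
      Wmul x y 0 1
        = x 0 0 * y 0 1 + x 0 1 * y 0 0 - x 0 2 * y 0 3 - x 0 3 * y 0 2,
      Wmul x y 0 2
        = x 0 0 * y 0 2 + x 0 1 * y 0 1 + x 0 2 * y 0 0 - x 0 3 * y 0 3
    & Wmul x y 0 3
        = x 0 0 * y 0 3 + x 0 1 * y 0 2 + x 0 2 * y 0 1 + x 0 3 * y 0 0].
Proof. by split; rewrite !mxE /= !(mulr0, mulr1, addr0, add0r). Qed.

Lemma row4P (R : realType) (x y : 'rV[R]_4) :
  [/\ x 0 0 = y 0 0, x 0 1 = y 0 1, x 0 2 = y 0 2 & x 0 3 = y 0 3] -> x = y.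
Proof.
case=> e0 e1 e2 e3; apply/rowP => -[[|[|[|[|//]]]] lt_i4].
- by have -> : Ordinal lt_i4 = 0 by apply: val_inj.
- by have -> : Ordinal lt_i4 = 1 by apply: val_inj.
- by have -> : Ordinal lt_i4 = 2 by apply: val_inj.
- by have -> : Ordinal lt_i4 = 3 by apply: val_inj.
Qed.

Lemma WmulC (R : realType) : commutative (@Wmul R).
Proof.
move=> x y; apply: row4P.
have [-> -> -> ->] := WmulE R x y; have [-> -> -> ->] := WmulE R y x.
by split; ring.
Qed.

Lemma WmulA (R : realType) : associative (@Wmul R).
Proof.
move=> x y z; apply: row4P.
have [-> -> -> ->] := WmulE R x (Wmul y z).
have [-> -> -> ->] := WmulE R (Wmul x y) z.
have [-> -> -> ->] := WmulE R x y; have [-> -> -> ->] := WmulE R y z.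
by split; ring.
Qed.

Lemma Wmul1x (R : realType) : left_id (W1 R) (@Wmul R).
Proof.
move=> x; apply: row4P; have [-> -> -> ->] := WmulE R (W1 R) x.
by rewrite !mxE /=; split; ring.
Qed.

Lemma WmulDl (R : realType) : left_distributive (@Wmul R) +%R.
Proof.
move=> x y z; apply: row4P; have [-> -> -> ->] := WmulE R (x + y) z.
(* The pattern keeps [mxE] on the outer sum; unrestricted, it would also unfold [Wmul] and [WmulE]
   could no longer match. *)
rewrite ![(Wmul x z + _) _ _]mxE.
have [-> -> -> ->] := WmulE R x z; have [-> -> -> ->] := WmulE R y z.
by rewrite !mxE; split; ring.
Qed.

Lemma WscaleAl (R : realType) (a : R) (x y : 'rV[R]_4) :
  a *: Wmul x y = Wmul (a *: x) y.
Proof.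
apply: row4P; have [-> -> -> ->] := WmulE R (a *: x) y.
rewrite ![(a *: Wmul x y) _ _]mxE; have [-> -> -> ->] := WmulE R x y.
by rewrite !mxE; split; ring.
Qed.

Lemma W1_neq0 (R : realType) : W1 R != 0.
Proof. by apply/eqP => /rowP/(_ 0)/eqP; rewrite !mxE oner_eq0. Qed.

(* An alias, so that this product does not become canonical on 'rV[R]_4. *)
Definition Walg (R : realType) : Type := 'rV[R]_4.

(** Addition and scaling are inherited from row vectors, so they agree with the given ones by
    conversion. *)
HB.instance Definition _ (R : realType) := GRing.Lmodule.on (Walg R).
HB.instance Definition _ (R : realType) :=
  (* One-sided unit and distributivity laws suffice, by commutativity. *)
  GRing.Zmodule_isComNzRing.Build (Walg R)
    (WmulA R) (WmulC R) (Wmul1x R) (WmulDl R) (W1_neq0 R).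
HB.instance Definition _ (R : realType) :=
  GRing.Lmodule_isLalgebra.Build R (Walg R) (WscaleAl R).
(** Compatibility of scaling with the right factor follows from [WscaleAl] and commutativity. *)
HB.instance Definition _ (R : realType) :=
  GRing.Lalgebra_isComAlgebra.Build R (Walg R).

Theorem theorem1 (R : realType) :
  @is_comAlgebra R 'rV[R]_4 (@Wmul R) (W1 R).
Proof.
(* [Walg R] unfolds to the row vectors, so all four agreements hold by computation. *)
by exists (GRing.ComAlgebra.class (Walg R)); split.
Qed.
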